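(* Let $P$ be a finite poset that is a block. Then: (S1) if $\dim_2(P)=|P|$, then $P\in\mathbb{A}_{2,3,4}\cup\mathbb{B}\cup\{Z\}$; (S2) if $\operatorname{cw}(P)=|P|$, then $P\in\mathbb{A}\cup\mathbb{B}\cup\{Z\}$.
   Context: An inclusion representation of $P$ is a family $(S_x:x\in P)$ of sets with $x\le y$ iff $S_x\subseteq S_y$; its ground set is $\bigcup_xS_x$. $\dim_2(P)$ is the least size of the ground set of an inclusion representation of $P$. $\operatorname{ch}(P)$ is the least $h$ such that some inclusion representation has all $|S_x|\le h$; $\operatorname{cw}(P)$ is the least ground-set size of an inclusion representation with all $|S_x|\le\operatorname{ch}(P)$. The vertical sum $Q_1<Q_2$ of disjoint posets is their union with the orders of $Q_1,Q_2$ and additionally every element of $Q_1$ below every element of $Q_2$. A block is a poset that is a chain or cannot be written as $Q_1<Q_2$ with $Q_1,Q_2$ non-empty. The disjoint sum $C+T$ is the union of $C$ and $T$ with no comparabilities between them. $Z$ is the four-element poset with three components. $\mathbb{A}$ is the set of antichains with at least two elements; $\mathbb{A}_{2,3,4}$ the antichains of sizes 2, 3, 4; $\mathbb{B}$ the posets $C+T$ with $C$ a chain with at least two elements and $T$ a one-element poset. *)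

(* Defs.v *)
From mathcomp Require Import all_boot all_order.
From mathcomp Require Import boolp.

Set Implicit Arguments.
Unset Strict Implicit.
Unset Printing Implicit Defensive.

Import Order.TTheory.

Section InclusionRepresentations.
Context {d : Order.disp_t} (P : finPOrderType d).

Definition inclusion_rep (U : finType) (S : P -> {set U}) : Prop :=
  forall x y : P, (x <= y)%O <-> S x \subset S y.

(* Only the members of the sets S x count; U itself may be larger. *)
Definition ground (U : finType) (S : P -> {set U}) : {set U} :=
  \bigcup_(x : P) S x.

(* Finite carriers U lose no generality: each of the three parameters below
   is the least value of a finite size, and a family of sets with a finite
   ground set lives on that ground set. *)
Definition has_rep_of_size (n : nat) : Prop :=
  exists (U : finType) (S : P -> {set U}),
    inclusion_rep S /\ #|ground S| = n.

Definition has_rep_of_height (h : nat) : Prop :=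
  exists (U : finType) (S : P -> {set U}),
    inclusion_rep S /\ (forall x, #|S x| <= h).

Definition has_rep_of_height_size (h n : nat) : Prop :=
  exists (U : finType) (S : P -> {set U}),
    [/\ inclusion_rep S, forall x, #|S x| <= h & #|ground S| = n].

Lemma inclusion_rep_downset :
  inclusion_rep (fun x : P => [set z | (z <= x)%O]).
Proof.
move=> x y; split=> [lexy|/subsetP/(_ x)].
  by apply/subsetP => z; rewrite !inE => /le_trans; apply.
by rewrite !inE; apply.
Qed.

Lemma ex_rep_size : exists n, `[< has_rep_of_size n >].
Proof.
exists #|ground (fun x : P => [set z | (z <= x)%O])|; apply/asboolP.
exists P, (fun x : P => [set z | (z <= x)%O]); split=> //.
exact: inclusion_rep_downset.
Qed.

Definition dim2 : nat := ex_minn ex_rep_size.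

Lemma ex_rep_height : exists h, `[< has_rep_of_height h >].
Proof.
exists #|P|; apply/asboolP.
exists P, (fun x : P => [set z | (z <= x)%O]).
by split=> [|x]; [exact: inclusion_rep_downset | exact: max_card].
Qed.

Definition ch : nat := ex_minn ex_rep_height.

Lemma ex_rep_ch_size : exists n, `[< has_rep_of_height_size ch n >].
Proof.
rewrite /ch; case: ex_minnP => h /asboolP[U [S [repS leSh]]] _.
by exists #|ground S|; apply/asboolP; exists U, S.
Qed.

Definition cw : nat := ex_minn ex_rep_ch_size.

End InclusionRepresentations.

Section Blocks.
Context {d : Order.disp_t} (P : finPOrderType d).

Definition chain (A : {set P}) : Prop :=
  {in A &, forall x y, (x >=< y)%O}.

Definition antichain (A : {set P}) : Prop :=
  {in A &, forall x y, x != y -> (x >< y)%O}.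

(* P is the union of the disjoint sets A and B, which carry the induced
   order. *)
Definition splits (A B : {set P}) : Prop :=
  A :|: B = [set: P] /\ [disjoint A & B].

Definition vertical_sum (Q1 Q2 : {set P}) : Prop :=
  splits Q1 Q2 /\ {in Q1 & Q2, forall x y, (x < y)%O}.

Definition disjoint_sum (C T : {set P}) : Prop :=
  splits C T /\ {in C & T, forall x y, (x >< y)%O}.

Definition block : Prop :=
  chain [set: P] \/
  ~ (exists Q1 Q2 : {set P},
       [/\ Q1 != set0, Q2 != set0 & vertical_sum Q1 Q2]).

Definition in_A : Prop := antichain [set: P] /\ 2 <= #|P|.

Definition in_A234 : Prop := antichain [set: P] /\ #|P| \in [:: 2; 3; 4].

Definition in_B : Prop :=
  exists C T : {set P},
    [/\ disjoint_sum C T, chain C, 2 <= #|C| & #|T| = 1].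

(* The components are those of the comparability graph; a poset with four
   elements and three components is unique up to isomorphism. *)
Definition is_Z : Prop :=
  #|P| = 4 /\ n_comp (fun x y : P => (x >=< y)%O) P = 3.

End Blocks.

(* Main.v *)
Require Import Defs.
From mathcomp Require Import all_boot all_order.
From mathcomp Require Import boolp.

Import Order.TTheory.

(* Write [dn x] and [sdn x] for the closed and open down-sets of x. Call P shrinkable if it has a
   representation by subsets of P minus a point with all sizes at most max |dn y|.
   If an optimal representation S for cw has |P| ground elements, match each x with an element of
   S x lying in no S y with y < x. A set of x violating Hall's condition, of maximal deficiency,
   lets one replace part of the ground set by fewer elements; so there is a system of distinct
   representatives, and |dn x| <= |S x| <= ch P. Hence cw P = |P| fails when P is shrinkable.
   Suppose P is not shrinkable. Deleting p from the sets dn x shows that no p is the supremum of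
   sdn p. Replacing dn t, for t maximal, by sdn t plus one or two further points shows that the
   open down-sets of maximal elements are nested, and that, if E = sdn t is the least of them, the
   set X of all w with sdn w not inside E is a chain all of whose elements have a unique lower
   cover. Then E lies below everything else, so E is empty when P is a block, and P is an antichain
   or a chain plus isolated points. The latter is shrinkable except for the classes B and Z:
   isolated points can be represented by pairs sharing elements.
   Finally, five elements of an antichain can be represented by the four edges of a 4-cycle and
   one of its diagonals. *)

(** * Hall's marriage theorem and its deficiency version *)

Section Hall.
Context {I T : finType}.
Implicit Types (R : I -> {set T}) (A B X : {set I}).

Definition neighbours R A : {set T} := \bigcup_(i in A) R i.

Lemma neighboursU R A B : neighbours R (A :|: B) = neighbours R A :|: neighbours R B.
Proof. exact: bigcup_setU. Qed.

Lemma neighboursD R A (Y : {set T}) :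
  neighbours (fun i => R i :\: Y) A = neighbours R A :\: Y.
Proof.
apply/setP => t; rewrite inE; apply/bigcupP/andP => [[i iA]|[tY /bigcupP[i iA tR]]].
  by rewrite inE => /andP[tY tR]; split=> //; apply/bigcupP; exists i.
by exists i; rewrite // inE tY.
Qed.

(** Induction on the size of [A]. If a non-empty proper [B] is tight, it is matched inside its
    neighbours and the rest is matched outside them. Otherwise every non-empty proper subset has a
    neighbour to spare, so one index may take any of its elements. The value [t0] only makes [m]
    total when [A] is empty. *)
Lemma hall R (t0 : T) A :
    (forall B, B \subset A -> #|B| <= #|neighbours R B|) ->
  exists m : I -> T, {in A &, injective m} /\ {in A, forall i, m i \in R i}.
Proof.
have [n] := ubnP #|A|; elim: n R A => // n IHn R A leAn hallA.
have [->|[i iA]] := set_0Vmem A.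
  by exists (fun=> t0); split=> [i j|i]; rewrite inE.
have [|/existsPn tightN] :=
    boolP [exists B : {set I}, [&& B != set0, B \proper A & #|neighbours R B| <= #|B|]].
  case/existsP => B /and3P[B0 ltBA leNB].
  have sBA := proper_sub ltBA.
  have [|C sCB|m1 [inj1 R1]] := IHn R B.
  - by apply: leq_trans (proper_card ltBA) _; rewrite -ltnS.
  - by apply: hallA; apply: subset_trans sCB sBA.
  have [||m2 [inj2 R2]] := IHn (fun i => R i :\: neighbours R B) (A :\: B).
  - apply: leq_trans (_ : #|A :\: B| < #|A|) _; last by rewrite -ltnS.
    by rewrite -(cardsID B A) (setIidPr sBA) -[ltnLHS]add0n ltn_add2r card_gt0.
  - move=> C; rewrite subsetD => /andP[sCA dCB]; rewrite neighboursD.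
    have := hallA (C :|: B); rewrite subUset sCA sBA neighboursU => /(_ isT).
    rewrite -[X in _ <= X]addn0 cardsU disjoint_setI0 // cards0 subn0 addn0.
    rewrite -(cardsID (neighbours R B) (_ :|: _)) setIUl setIid setDUl setDv setU0.
    rewrite (setUidPr (subsetIr _ _)) addnC => le1.
    by rewrite -(leq_add2l #|B|); apply: leq_trans le1 _; rewrite leq_add2r.
  have mN j : j \in B -> m1 j \in neighbours R B.
    by move=> jB; apply/bigcupP; exists j => //; apply: R1.
  have m2P j : j \in A -> j \notin B -> (m2 j \in R j) /\ (m2 j \notin neighbours R B).
    by move=> jA jB; have := R2 j; rewrite !inE jA jB => /(_ isT)/andP[].
  exists (fun j => if j \in B then m1 j else m2 j); split=> [j k jA kA|j jA].
    case: ifPn => jB; case: ifPn => kB; first exact: inj1.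
    - by have [_ /negP nN] := m2P k kA kB => eqm; case: nN; rewrite -eqm mN.
    - by have [_ /negP nN] := m2P j jA jB => eqm; case: nN; rewrite eqm mN.
    - by apply: inj2; rewrite !inE ?jA ?kA ?jB ?kB.
  by case: ifPn => jB; [exact: R1 | case: (m2P j jA jB)].
have [t tR] : exists t, t \in R i.
  apply/set0Pn; rewrite -card_gt0.
  by have := hallA [set i]; rewrite sub1set cards1 /neighbours big_set1; apply.
have [||m [injm Rm]] := IHn (fun i => R i :\: [set t]) (A :\ i).
- by move: leAn; rewrite (cardsD1 i A) iA.
- move=> C sCA; rewrite neighboursD.
  have [->|C0] := eqVneq C set0; first by rewrite cards0.
  have pCA : C \proper A by apply: sub_proper_trans sCA (properD1 iA).
  have := tightN C; rewrite C0 pCA -ltnNge /= (cardsD1 t (neighbours R C)).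
  by move=> lt1; rewrite -ltnS (leq_trans lt1) // -add1n leq_add2r leq_b1.
have mP j : j \in A -> j != i -> (m j \in R j) /\ (m j != t).
  by move=> jA ji; have := Rm j; rewrite !inE jA ji => /(_ isT)/andP[].
exists (fun j => if j == i then t else m j); split=> [j k jA kA|j jA].
  case: eqVneq => [-> |ji]; case: eqVneq => [->//|ki].
  - by have [_ /eqP nt] := mP k kA ki => eqm; case: nt.
  - by have [_ /eqP nt] := mP j jA ji => eqm; case: nt.
  - by apply: injm; rewrite !inE ?jA ?kA ?ji ?ki.
by case: eqVneq => [-> //|ji]; case: (mP j jA ji).
Qed.

(* X is chosen of maximal deficiency: Hall's condition then holds outside X. *)
Lemma hall_or_deficient R (t0 : T) :
  (exists m : I -> T, injective m /\ forall i, m i \in R i) \/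
  (exists X (m : I -> T), [/\ #|neighbours R X| < #|X|,
     {in ~: X &, injective m} &
     {in ~: X, forall i, m i \in R i :\: neighbours R X}]).
Proof.
have [/existsP[X0 defX0]|/existsPn noX] :=
    boolP [exists X, #|neighbours R X| < #|X|]; [right | left].
  (* The deficiency of [X], shifted by the size of [T] to avoid truncated subtraction. *)
  pose g X := #|X| + #|~: neighbours R X|.
  have [X _ maxX] := arg_maxnP g (erefl true : xpredT X0).
  have defX : #|neighbours R X| < #|X|.
    rewrite -(ltn_add2r #|~: neighbours R X|) cardsC.
    apply: leq_trans (maxX X0 isT).
    by rewrite -(cardsC (neighbours R X0)) /g ltn_add2r.
  have [|m [injm Rm]] := @hall (fun i => R i :\: neighbours R X) t0 (~: X).
    move=> B; rewrite subsets_disjoint setCK neighboursD => dBX.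
    have : g (X :|: B) <= g X by apply: maxX.
    rewrite /g neighboursU cardsU setIC disjoint_setI0 // cards0 subn0 -addnA leq_add2l.
    rewrite -(cardsID (neighbours R B) (~: neighbours R X)) setCU -setDE leq_add2r.
    by rewrite setIC -setDE.
  by exists X, m.
have [|m [injm Rm]] := @hall R t0 setT.
  by move=> B _; rewrite leqNgt.
by exists m; split=> [i j|i]; [apply: injm | apply: Rm]; rewrite inE.
Qed.

End Hall.

Section Representations.
Context {d : Order.disp_t} {P : finPOrderType d}.
Implicit Types x y z : P.

Definition dn x : {set P} := [set z | (z <= x)%O].
Definition sdn x : {set P} := [set z | (z < x)%O].

(** * Compressing a representation with |P| ground elements *)

Section Compression.
Context {U : finType} (S : P -> {set U}).

Definition fresh x : {set U} := S x :\: \bigcup_(y | (y < x)%O) S y.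

Lemma fresh_sub x : fresh x \subset S x.
Proof. exact: subsetDl. Qed.

Lemma ex_fresh u x : u \in S x -> exists2 y, (y <= x)%O & u \in fresh y.
Proof.
have [n] := ubnP #|dn x|; elim: n x => // n IHn x lex ux.
have [/bigcupP[y ltyx uy]|nu] := boolP (u \in \bigcup_(y | (y < x)%O) S y).
  have [||z lezy uz] := IHn y => //.
    rewrite -ltnS; apply: leq_trans lex; rewrite ltnS; apply: proper_card.
    rewrite properEneq; apply/andP; split.
      apply/eqP => /setP/(_ x); rewrite !inE lexx => /(lt_le_trans ltyx).
      by rewrite ltxx.
    by apply/subsetP => z; rewrite !inE => /le_trans; apply; apply: ltW.
  by exists z => //; apply: le_trans lezy (ltW ltyx).
by exists x; rewrite // inE nu.
Qed.

(** Distinct representatives of the sets [fresh y] inject [dn x] into [S x]. Without them, a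
    deficient [X] has neighbours [V] with |V| < |X|. Keeping [V], and replacing what is fresh at
    each y outside [X] by the single element [m y], leaves fewer than |P| ground elements. *)
Lemma compress : inclusion_rep S -> #|ground S| = #|P| -> 0 < #|P| ->
  (forall x, #|dn x| <= #|S x|) \/
  exists S' : P -> {set U}, [/\ inclusion_rep S',
    forall x, #|S' x| <= #|S x| & #|ground S'| < #|P|].
Proof.
move=> repS cardS P0.
have [u0 _] : exists u, u \in ground S by apply/set0Pn; rewrite -card_gt0 cardS.
have SS x y : (x <= y)%O -> S x \subset S y by move/repS.
case: (hall_or_deficient fresh u0) => [[m [injm freshm]]|[X [m [defX injm freshm]]]].
  left=> x; rewrite -(card_imset _ injm); apply: subset_leq_card.
  apply/subsetP => _ /imsetP[y + ->]; rewrite inE => /SS/subsetP; apply.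
  exact: subsetP (fresh_sub y) _ (freshm y).
right; pose V := neighbours fresh X.
pose S' x := (S x :&: V) :|: [set m y | y in dn x :\: X].
have mP y : y \notin X -> m y \in fresh y /\ m y \notin V.
  by move=> yX; have := freshm y; rewrite !inE yX => /(_ isT)/andP[].
have sS' x : S' x \subset S x.
  rewrite subUset subsetIl; apply/subsetP => _ /imsetP[y + ->].
  rewrite !inE => /andP[/mP[my _] /SS/subsetP]; apply.
  exact: subsetP (fresh_sub y) _ my.
exists S'; split=> [x y|x|]; last 1 first.
- apply: leq_ltn_trans (_ : #|V :|: [set m y | y in ~: X]| < _).
    apply: subset_leq_card; apply/bigcupsP => x _; apply: setUSS.
      exact: subsetIr.
    by apply: imsetS; apply/subsetP => y; rewrite !inE => /andP[].
  apply: leq_ltn_trans (leq_card_setU _ _) _.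
  apply: leq_ltn_trans (_ : #|V| + #|~: X| < _).
    by rewrite leq_add2l leq_imset_card.
  by rewrite -(cardsC X) ltn_add2r.
- split=> [lexy|sS].
    apply: setUSS; first by apply: setSI; apply: SS.
    apply: imsetS; apply: setSD; apply/subsetP => z; rewrite !inE => /le_trans.
    by apply.
  apply/repS; apply/subsetP => u ux; apply: contraT => nuy.
  (* An element u of [S x] outside [S y] is fresh at some x' below x. If u is in [V] it survives in
     [S' x]. Otherwise [m x'] takes its place, and by injectivity it lies in [S' y] only if x' <= y,
     which would put u in [S y]. *)
  have [x' lex'x ux'] := ex_fresh _ _ ux.
  have [uV|nuV] := boolP (u \in V).
    have /(subsetP sS) : u \in S' x by rewrite !inE ux uV.
    by move/(subsetP (sS' y)); rewrite (negPf nuy).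
  have x'X : x' \notin X.
    by apply: contra nuV => x'X; apply/bigcupP; exists x'.
  have [mx' mx'V] := mP _ x'X.
  have : m x' \in S' x.
    by rewrite inE; apply/orP; right; apply: imset_f; rewrite !inE x'X.
  move/(subsetP sS); rewrite !inE (negPf mx'V) andbF /=.
  case/imsetP => z; rewrite !inE => /andP[zX lezy] /injm; rewrite !inE => /(_ x'X zX) eqz.
  move: nuy; rewrite -eqz in lezy; rewrite (subsetP (SS _ _ lezy)) //.
  exact: subsetP (fresh_sub x') _ ux'.
- exact: subset_leq_card.
Qed.

End Compression.

(** The other outcome of [compress] would be a smaller ground set within the same height bound. *)
Lemma card_dn_le_ch : 0 < #|P| -> cw P = #|P| -> forall x, #|dn x| <= ch P.
Proof.
rewrite /cw; case: ex_minnP => n /asboolP[U [S [repS leS <-]]] minn P0 cardS x.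
have [le_dn|[S' [repS' leS' ltS']]] := compress S repS cardS P0.
  exact: leq_trans (le_dn x) (leS x).
have := minn #|ground S'|; rewrite cardS leqNgt ltS' => /(_ _)/negP[] //.
by apply/asboolP; exists U, S'; split=> // y; apply: leq_trans (leS' y) (leS y).
Qed.

(** * Shrinkable posets and modified down-set representations *)

Definition rep_avoiding (p : P) (S : P -> {set P}) : Prop :=
  inclusion_rep S /\ forall x, p \notin S x.

(** The sizes are bounded by those of down-sets and not by [ch P], so that the condition can be
    tested on the order alone; [card_dn_le_ch] links the two bounds when [cw P] equals |P|. *)
Definition shrinkable : Prop :=
  exists p S, rep_avoiding p S /\ forall x, exists y, #|S x| <= #|dn y|.

Lemma card_ground_avoiding p S : rep_avoiding p S -> #|ground S| < #|P|.
Proof.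
case=> _ avoid; rewrite -cardsT; apply: proper_card; rewrite properE subsetT /=.
apply/subsetPn; exists p; rewrite ?inE //.
by apply/bigcupP => -[x _]; rewrite (negPf (avoid x)).
Qed.

Lemma dim2_lt_card p S : rep_avoiding p S -> dim2 P < #|P|.
Proof.
move=> avoid; apply: leq_ltn_trans (card_ground_avoiding _ _ avoid).
rewrite /dim2; case: ex_minnP => n _; apply; apply/asboolP.
by exists P, S; split=> //; case: avoid.
Qed.

Lemma shrinkable_cw : 0 < #|P| -> shrinkable -> cw P <> #|P|.
Proof.
move=> P0 [p [S [avoid leS]]] eqcw.
have le_dn := card_dn_le_ch P0 eqcw.
have := card_ground_avoiding _ _ avoid; rewrite -eqcw ltnNge => /negP; apply.
rewrite /cw; case: ex_minnP => n _; apply; apply/asboolP.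
exists P, S; split=> [|x|//]; first by case: avoid.
by have [y le_y] := leS x; apply: leq_trans le_y (le_dn y).
Qed.

Lemma dn_rep : inclusion_rep dn.
Proof. exact: inclusion_rep_downset. Qed.

Lemma dnE x y : (dn x \subset dn y) = (x <= y)%O.
Proof. by apply/idP/idP => /dn_rep. Qed.

Lemma card_dn x : #|dn x| = #|sdn x|.+1.
Proof.
by rewrite (cardsD1 x) inE lexx; congr _.+1; apply: eq_card => z; rewrite !inE lt_neqAle.
Qed.

(** Once p is deleted from all down-sets, every other x still lies in its own set and certifies the
    order. Only the set of p loses its certificate, and the hypothesis that p is the supremum of
    [sdn p] replaces it. *)
Lemma shrinkable_sup p :
  (forall y, sdn p \subset dn y -> (p <= y)%O) -> shrinkable.
Proof.
move=> supp; exists p, (fun x => dn x :\ p); split; last first.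
  by move=> x; exists x; rewrite (cardsD1 p (dn x)) leq_addl.
split=> [x y|x]; last by rewrite !inE eqxx.
split=> [lexy|sxy]; first by apply: setSD; rewrite dnE.
have [eqx|nex] := eqVneq x p; last first.
  by have := subsetP sxy x; rewrite !inE nex lexx => /(_ isT).
rewrite eqx; apply: supp; rewrite -eqx; apply/subsetP => z; rewrite inE lt_neqAle => /andP[nez lezx].
by have := subsetP sxy z; rewrite !inE -eqx nez lezx => /(_ isT).
Qed.

Definition update (T : {set P}) (f : P -> {set P}) x := if x \in T then f x else dn x.

Lemma update_rep (T : {set P}) (f : P -> {set P}) :
    {in T &, forall t u, f t \subset f u -> t = u} ->
    {in T & ~: T, forall t x, (t <= x)%O = (f t \subset dn x)} ->
    {in T & ~: T, forall t x, (x <= t)%O = (dn x \subset f t)} ->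
    {in T &, forall t u, (t <= u)%O -> t = u} ->
  inclusion_rep (update T f).
Proof.
move=> fT up down antiT x y; rewrite /update.
have [[xT|xT] [yT|yT]] := (boolP (x \in T), boolP (y \in T)).
- by split=> [/antiT ->|/fT ->].
- by rewrite up // inE.
- by rewrite down // inE.
- by rewrite dnE.
Qed.

(** * New sets for isolated points *)

Definition isolated x : Prop := forall y, (y >=< x)%O -> y = x.

(** For t in [T] and x outside, the sets [f t] and [dn x] must be incomparable. An isolated point of
    [T] in [f t] prevents one inclusion; an element below x that is missing from [f t] prevents the
    other. *)
Lemma update_isolated (T : {set P}) (f : P -> {set P}) p :
    {in T, forall t, isolated t} -> p \in T ->
    {in T &, forall t u, f t \subset f u -> t = u} ->
    {in T, forall t, exists2 u, u \in f t & u \in T} ->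
    {in T & ~: T, forall t x, x \in f t -> exists2 y, (y < x)%O & y \notin f t} ->
    {in T, forall t, p \notin f t} ->
  rep_avoiding p (update T f).
Proof.
move=> isoT pT fT meetT downT avoidT.
have iso_le t x : t \in T -> (t <= x)%O -> t = x.
  by move=> tT lex; rewrite (isoT t tT x) // /Order.comparable lex orbT.
have iso_ge t x : t \in T -> (x <= t)%O -> x = t.
  by move=> tT lex; rewrite (isoT t tT x) // /Order.comparable lex.
split; last first.
  move=> x; rewrite /update; case: ifPn => [|xT]; first exact: avoidT.
  by rewrite inE; apply: contra xT => /(iso_le _ _ pT) <-.
apply: update_rep => // [t x tT|t x tT|t u tT _ /(iso_le _ _ tT)] //; rewrite inE => xT.
- apply/idP/idP => [/(iso_le _ _ tT) eqx|sfx]; first by rewrite -eqx tT in xT.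
  have [u uf uT] := meetT t tT; have := subsetP sfx u uf.
  by rewrite inE => /(iso_le _ _ uT) eqx; rewrite -eqx uT in xT.
- apply/idP/idP => [/(iso_ge _ _ tT) eqx|sxf]; first by rewrite eqx tT in xT.
  have [||y ltyx /negP[]] := downT t x tT; rewrite ?inE //.
    by apply: (subsetP sxf); rewrite inE.
  by apply: (subsetP sxf); rewrite inE ltW.
Qed.

(** Pairs are small enough because b is not minimal, so [dn b] has at least two elements. *)
Lemma shrinkable_isolated (T : {set P}) (f : P -> {set P}) p b :
  rep_avoiding p (update T f) -> {in T, forall t, #|f t| <= 2} ->
  sdn b != set0 -> shrinkable.
Proof.
move=> avoid f2 b0; exists p, (update T f); split=> // x; rewrite /update.
case: ifPn => [xT|_]; last by exists x.
by exists b; apply: leq_trans (f2 x xT) _; rewrite card_dn ltnS card_gt0.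
Qed.

Lemma shrinkable_isolated2 t1 t2 b c :
    isolated t1 -> isolated t2 -> t1 != t2 -> b != c ->
    sdn b != set0 -> sdn c != set0 -> shrinkable.
Proof.
move=> iso1 iso2 ne12 nebc b0 c0.
have nmin x y : isolated x -> sdn y != set0 -> y != x.
  move=> isox /set0Pn[z]; rewrite inE => ltzy; apply: contraTneq ltzy => ->.
  by apply/negP => ltzx; move: (ltzx); rewrite (isox z) ?ltxx // /Order.comparable ltW.
have below z x t : (z < x)%O -> isolated t -> z != t.
  move=> ltzx isot; apply: contraTneq (ltzx) => eqz; apply/negP => lttx.
  by move: (ltzx); rewrite eqz (isot x) ?ltxx // /Order.comparable -eqz (ltW ltzx) orbT.
(* The two pairs share t1, which frees t2. As b and c are not minimal, their down-sets do not fit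
   into these pairs. *)
pose f x := if x == t1 then [set b; t1] else [set c; t1].
apply: (@shrinkable_isolated [set t1; t2] f t2 b) => //; last first.
  by move=> t _; rewrite /f; case: ifP => _; rewrite cards2; case: (_ != _).
have [[[b1 b2] c1] c2] := (nmin _ _ iso1 b0, nmin _ _ iso2 b0, nmin _ _ iso1 c0, nmin _ _ iso2 c0).
have f1 : f t1 = [set b; t1] by rewrite /f eqxx.
have f2 : f t2 = [set c; t1] by rewrite /f eq_sym (negPf ne12).
apply: update_isolated => [t|||t|t x|t]; rewrite ?inE ?eqxx ?orbT //.
- by case/orP => /eqP->.
- move=> t u; rewrite !inE => /orP[]/eqP-> /orP[]/eqP-> //; rewrite f1 f2 subUset !sub1set !inE.
    by rewrite (negPf nebc) (negPf b1).
  by rewrite eq_sym (negPf nebc) (negPf c1).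
- by move=> tT; exists t1; rewrite ?inE ?eqxx // /f; case: ifP; rewrite !inE eqxx orbT.
- rewrite negb_or => /orP[]/eqP-> /andP[x1 x2]; rewrite ?f1 ?f2 !inE (negPf x1) orbF => /eqP eqx; subst x.
    have /set0Pn[z] := b0; rewrite inE => ltz; exists z => //.
    by rewrite !inE lt_eqF //= (below _ _ _ ltz).
  have /set0Pn[z] := c0; rewrite inE => ltz; exists z => //.
  by rewrite !inE lt_eqF //= (below _ _ _ ltz).
- by case/orP => /eqP->; rewrite ?f1 ?f2 !inE [t2 == t1]eq_sym (negPf ne12) orbF eq_sym.
Qed.

Lemma shrinkable_isolated3 t1 t2 t3 b :
    isolated t1 -> isolated t2 -> isolated t3 ->
    t1 != t2 -> t2 != t3 -> t3 != t1 -> sdn b != set0 -> shrinkable.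
Proof.
move=> iso1 iso2 iso3 ne12 ne23 ne31 b0.
have nmin x : isolated x -> b != x.
  move=> isox; have /set0Pn[z] := b0; rewrite inE => ltzb; apply: contraTneq ltzb => ->.
  by apply/negP => ltzx; move: (ltzx); rewrite (isox z) ?ltxx // /Order.comparable ltW.
have below z t : (z < b)%O -> isolated t -> z != t.
  move=> ltzb isot; apply: contraTneq (ltzb) => eqz; apply/negP => lttb.
  by move: (ltzb); rewrite eqz (isot b) ?ltxx // /Order.comparable -eqz (ltW ltzb) orbT.
(* The three edges of the triangle on b, t1, t3; the point t2 is freed. *)
pose f x := if x == t1 then [set b; t1] else if x == t2 then [set t1; t3] else [set t3; b].
apply: (@shrinkable_isolated [set t1; t2; t3] f t2 b) => //; last first.
  by move=> t _; rewrite /f; do 2?case: ifP => _; rewrite cards2; case: (_ != _).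
have [[b1 b2] b3] := (nmin _ iso1, nmin _ iso2, nmin _ iso3).
have [ne21 ne32 ne13] : [/\ t2 != t1, t3 != t2 & t1 != t3] by split; rewrite eq_sym.
have neE := (negPf ne12, negPf ne23, negPf ne31, negPf ne21, negPf ne32, negPf ne13).
have bE := (negPf b1, negPf b2, negPf b3).
have bE' x : x \in [:: t1; t2; t3] -> (x == b) = false.
  by rewrite [x == b]eq_sym !inE => /or3P[]/eqP->; rewrite bE.
have [b1' b2' b3'] : [/\ (t1 == b) = false, (t2 == b) = false & (t3 == b) = false].
  by split; apply: bE'; rewrite !inE eqxx ?orbT.
have f1 : f t1 = [set b; t1] by rewrite /f eqxx.
have f2 : f t2 = [set t1; t3] by rewrite /f neE eqxx.
have f3 : f t3 = [set t3; b] by rewrite /f !neE.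
have fE := (f1, f2, f3).
apply: update_isolated => [t|||t|t x|t]; rewrite ?inE ?eqxx ?orbT //.
- by rewrite -orbA => /or3P[]/eqP->.
- move=> t u; rewrite !inE -!orbA => /or3P[]/eqP-> /or3P[]/eqP-> //;
  by rewrite !fE subUset !sub1set !inE ?neE ?bE ?b1' ?b2' ?b3' ?eqxx ?orbT ?andbF.
- rewrite -orbA => /or3P[]/eqP->; rewrite fE; [exists t1|exists t1|exists t3];
  by rewrite !inE eqxx ?orbT.
- rewrite !negb_or -orbA -andbA => /or3P[]/eqP-> /and3P[/negPf x1 /negPf x2 /negPf x3];
  rewrite fE !inE ?x1 ?x3 ?orbF //= => /eqP->; have /set0Pn[z] := b0; rewrite inE => ltz;
  by exists z => //; rewrite !inE (lt_eqF ltz) ?orbF /= (below _ _ ltz).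
- by rewrite -orbA => /or3P[]/eqP->; rewrite fE !inE ?neE ?b2'.
Qed.

(** Bounds only the ground set and so serves [dim2] alone: down-sets in an antichain are singletons,
    so the pairs used here give no shrinkability. *)
Lemma antichain_rep_avoiding : antichain [set: P] -> 4 < #|P| ->
  exists p S, rep_avoiding p S.
Proof.
move=> antiP; rewrite cardE; have := enum_uniq P.
case: (enum P) => [|a [|b [|c [|e [|g s]]]]] //= + _.
rewrite !inE !negb_or -!andbA => /and5P[ab ac ae ag]/and5P[_ bc be bg]/and5P[_ ce cg _]/and3P[eg _ _].
have neE := (negPf ab, negPf ac, negPf ae, negPf ag, negPf bc, negPf be, negPf bg, negPf ce,
  negPf cg, negPf eg).
have sym (x y : P) : x != y -> (y == x) = false by rewrite eq_sym => /negPf.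
have neE' := (sym _ _ ab, sym _ _ ac, sym _ _ ae, sym _ _ ag, sym _ _ bc, sym _ _ be, sym _ _ bg,
  sym _ _ ce, sym _ _ cg, sym _ _ eg).
pose T := [set a; b; c; e; g].
(* The 4-cycle a, b, c, e with the diagonal from a to c; the point g is freed. *)
pose f x := if x == a then [set a; b] else if x == b then [set b; c] else
  if x == c then [set c; e] else if x == e then [set e; a] else [set a; c].
have fE : (f a = [set a; b]) * (f b = [set b; c]) * (f c = [set c; e]) * (f e = [set e; a])
   * (f g = [set a; c]).
  by rewrite /f !neE' !eqxx.
have TP x : x \in T -> x = a \/ x = b \/ x = c \/ x = e \/ x = g.
  by rewrite !inE -!orbA; do 4?[case/orP => [/eqP|]; first by auto]; move/eqP; auto.
have [aT bT cT eT gT] : [/\ a \in T, b \in T, c \in T, e \in T & g \in T].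
  by rewrite !inE !eqxx !orbT.
exists g, (update T f); apply: update_isolated => // [t _ x|t u|t|t x|t].
- by apply: contraTeq => /antiP; rewrite !inE; apply.
- by move=> /TP[|[|[|[|]]]]-> /TP[|[|[|[|]]]]-> //; rewrite !fE subUset !sub1set !inE ?neE ?neE' ?eqxx ?orbT ?andbF.
- by move=> /TP[|[|[|[|]]]]->; rewrite fE; [exists a|exists b|exists c|exists e|exists a]; rewrite ?inE ?eqxx ?orbT.
- by move=> /TP[|[|[|[|]]]]->; rewrite !fE !inE !negb_or -!andbA => /and5P[/negPf xa /negPf xb /negPf xc /negPf xe _];
  rewrite ?xa ?xb ?xc ?xe.
- by move=> /TP[|[|[|[|]]]]->; rewrite fE !inE ?neE'.
Qed.

(** * Maximal elements and the replacement of their sets *)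

Definition maximal x : bool := [forall y, (x <= y)%O ==> (y == x)].

Lemma maximalP x : reflect (forall y, (x <= y)%O -> y = x) (maximal x).
Proof.
by apply: (iffP forallP) => maxx y; [move/implyP/(_ _)/eqP: (maxx y) | apply/implyP => /maxx ->].
Qed.

Lemma ex_maximal x : exists2 s, maximal s & (x <= s)%O.
Proof.
have [s lexs maxs] := arg_maxnP (fun y => #|dn y|) (lexx x : (fun y => x <= y)%O x).
exists s => //; apply/maximalP => y lesy; apply/eqP; rewrite eq_le lesy andbT -dnE.
have /eqP <- // : dn s == dn y.
by rewrite eqEcard dnE lesy; apply: maxs; apply: le_trans lexs lesy.
Qed.

(** By maximality t lies in no down-set but its own, so trading it for [W] there removes it from the
    ground set. The conditions on [W] exclude new inclusions, and z pays for the size. *)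
Lemma shrinkable_maximal t (W : {set P}) z :
    maximal t -> t \notin W -> (forall y, sdn t :|: W \subset dn y -> y = t) ->
    (forall x, dn x \subset sdn t :|: W -> (x <= t)%O) ->
    #|sdn t| + #|W| <= #|dn z| ->
  shrinkable.
Proof.
move=> /maximalP maxt tW ubW downW leW.
exists t, (update [set t] (fun=> sdn t :|: W)); split; last first.
  move=> x; rewrite /update; case: ifP => _; last by exists x.
  by exists z; apply: leq_trans leW; apply: leq_card_setU.
split; last first.
  move=> x; rewrite /update inE; case: eqVneq => [_|nex]; first by rewrite !inE ltxx.
  by rewrite inE; apply: contra nex => /maxt ->.
apply: update_rep => [u v|u x|u x|u v]; rewrite !inE; try by move=> /eqP-> /eqP->.
- move=> /eqP-> nex; apply/idP/idP => [/maxt eqx|/ubW eqx]; by rewrite eqx eqxx in nex.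
- move=> /eqP-> nex; apply/idP/idP => [lext|]; last exact: downW.
  apply/subsetP => y; rewrite !inE => leyx; apply/orP; left.
  by apply: le_lt_trans leyx _; rewrite lt_neqAle nex.
Qed.

(** * Structure of a poset that is not shrinkable and not a vertical sum *)

Section Structure.
Context (noshrink : ~ shrinkable) (novert : ~ exists Q1 Q2 : {set P},
  [/\ Q1 != set0, Q2 != set0 & vertical_sum Q1 Q2]).

Lemma not_sup p : exists2 y, sdn p \subset dn y & ~~ (p <= y)%O.
Proof.
apply: contrapT => noy; apply: noshrink; apply: (@shrinkable_sup p) => y sub.
by apply: contraT => nle; case: noy; exists y.
Qed.

Lemma sdn_maximal_nested t s : maximal t -> maximal s ->
  sdn t \subset sdn s \/ sdn s \subset sdn t.
Proof.
move=> maxt maxs; have [->|nets] := eqVneq t s; first by left.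
have [|nts] := boolP (sdn t \subset sdn s); [by left | right].
(* If neither set contains the other, t can be traded for s without changing the size of its set. *)
apply: contraT => nst; case: noshrink; apply: (@shrinkable_maximal t [set s] t) => //.
- by rewrite inE.
- move=> y; rewrite subUset sub1set inE => /andP[sub lesy].
  have eqy := maximalP _ maxs _ lesy; case/negP: nts; apply/subsetP => z ltzt.
  by have := subsetP sub z ltzt; rewrite !inE eqy lt_neqAle => ->; rewrite andbT;
    apply: contraTneq ltzt => ->; rewrite inE; apply/negP => /ltW/(maximalP _ maxs)/eqP; rewrite (negPf nets).
- move=> x sub; have := subsetP sub x; rewrite !inE lexx => /(_ isT)/orP[/ltW//|/eqP eqx].
  case/negP: nst; apply/subsetP => z; rewrite inE => ltzs.
  by have := subsetP sub z; rewrite !inE eqx ltW // (lt_eqF ltzs) orbF; apply.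
- by rewrite cards1 card_dn addn1.
Qed.

Context (t : P) (maxt : maximal t) (mint : forall s, maximal s -> #|sdn t| <= #|sdn s|).

Let E := sdn t.
Let X : {set P} := [set w | ~~ (sdn w \subset E)].

Lemma sub_sdn_maximal s : maximal s -> E \subset sdn s.
Proof.
move=> maxs; case: (sdn_maximal_nested _ _ maxt maxs) => // sub.
by have/eqP-> : sdn s == E; rewrite // eqEcard sub mint.
Qed.

Lemma sdn_sub x y : (x <= y)%O -> sdn x \subset sdn y.
Proof. by move=> lexy; apply/subsetP => z; rewrite !inE => /lt_le_trans; apply. Qed.

Lemma X_up x y : x \in X -> (x <= y)%O -> y \in X.
Proof. by rewrite !inE => + /sdn_sub lexy; apply: contra; apply: subset_trans. Qed.

Lemma notX_sub x : x \notin X -> sdn x \subset E.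
Proof. by rewrite inE negbK. Qed.

(** Without a common upper bound, t could be traded for w1 and w2. The set of size at most |E| + 2
    is affordable: a maximal s above w1 has [sdn s] strictly larger than [E], and [dn s] has one
    element more. *)
Lemma X_bounded w1 w2 : w1 \in X -> w2 \in X -> exists z, (w1 <= z)%O && (w2 <= z)%O.
Proof.
move=> X1 X2; apply: contrapT => noz; apply: noshrink.
have ub z : (w1 <= z)%O -> (w2 <= z)%O -> False.
  by move=> le1 le2; apply: noz; exists z; rewrite le1.
have [s maxs le1s] := ex_maximal w1.
have down v w : v \in X -> (forall z, (v <= z)%O -> (w <= z)%O -> False) ->
    dn v \subset E :|: [set v; w] -> False.
  rewrite inE => /negP vX ubvw sub; apply: vX; apply/subsetP => z; rewrite inE => ltzv.
  have := subsetP sub z; rewrite !inE ltW // (lt_eqF ltzv) /= => /(_ isT)/orP[//|/eqP eqz].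
  by case: (ubvw v) => //; rewrite -eqz ltW.
have sE : E \subset sdn s := sub_sdn_maximal s maxs.
have ltE : #|E| < #|sdn s|.
  apply: proper_card; rewrite properE sE.
  by have := X_up _ _ X1 le1s; rewrite inE.
have tX : t \notin X by rewrite inE negbK.
apply: (@shrinkable_maximal t [set w1; w2] s) => //.
- by rewrite !inE negb_or; apply/andP; split; apply: contraNneq tX => ->.
- move=> y; rewrite !subUset !sub1set !inE => /and3P[_ le1 le2].
  by case: (ub y le1 le2).
- move=> x sub; have := subsetP sub x; rewrite !inE lexx => /(_ isT)/or3P[/ltW//|/eqP eqx|/eqP eqx].
    by case: (down w1 w2 X1 ub); rewrite -{1}eqx.
  by case: (down w2 w1 X2) => [z le2 le1|]; [exact: (ub z) | rewrite [[set w2; w1]]setUC -{1}eqx].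
- rewrite card_dn cards2; apply: leq_trans (_ : #|E|.+2 <= _); last exact: ltE.
  by rewrite -addn2 leq_add2l; case: (_ != _).
Qed.

(** A non-empty [E] would form a vertical sum with its complement; this is where indecomposability
    enters. *)
Lemma no_lower_part : (forall e z, (e < t)%O -> ~~ (z < t)%O -> (e < z)%O) -> E = set0.
Proof.
move=> ltE; apply/eqP; apply: contraT => E0; case: novert; exists E, (~: E); split=> //.
  by apply/set0Pn; exists t; rewrite !inE ltxx.
split; first by split; [exact: setUCr | rewrite -subsets_disjoint].
by move=> e z; rewrite !inE => lte /(ltE _ _ lte).
Qed.

Lemma maximal_notX s : maximal s -> s \notin X -> sdn s = E.
Proof.
by move=> maxs /notX_sub sub; apply/eqP; rewrite eqEsubset sub sub_sdn_maximal.
Qed.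

Lemma lt_X z : ~~ (z < t)%O -> ~~ maximal z -> exists2 x, x \in X & (z < x)%O.
Proof.
move=> nE; rewrite negb_forall => /existsP[x]; rewrite negb_imply => /andP[lezx nex].
have ltzx : (z < x)%O by rewrite lt_neqAle eq_sym nex.
exists x => //; rewrite inE; apply/subsetPn; exists z; by rewrite inE.
Qed.

Lemma X0_antichain : X = set0 -> antichain [set: P].
Proof.
move=> X0.
have max z : ~~ (z < t)%O -> maximal z.
  by move=> nz; apply: contraT => /(lt_X _ nz)[x]; rewrite X0 inE.
have sdnE z : ~~ (z < t)%O -> sdn z = E.
  by move/max => maxz; apply: maximal_notX => //; rewrite X0 inE.
have E0 : E = set0.
  by apply: no_lower_part => e z lte /sdnE eqz; move/setP: eqz => /(_ e); rewrite !inE lte.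
have max' z : maximal z.
  by apply: max; move/setP: E0 => /(_ z); rewrite !inE => ->.
move=> x y _ _ ne; rewrite /Order.comparable; apply/norP; split; apply: contra ne.
  by move/(maximalP _ (max' x)) => ->.
by move/(maximalP _ (max' y)) => ->.
Qed.

(** Since g is not the supremum of [sdn g], some y bounds [sdn g] without being above g. If y were
    not below g, then y would be in [X], hence comparable to g, which is impossible. So y is the
    unique lower cover of g and inherits its comparabilities with [X]. *)
Lemma predecessor g : g \in X -> {in X, forall z, (z >=< g)%O} ->
  exists y, [/\ (y < g)%O, sdn g = dn y & y \in X -> {in X, forall z, (z >=< y)%O}].
Proof.
move=> gX compg; have [y sub nle] := not_sup g.
have ltyg : (y < g)%O.
  apply: contraT => nlt; have yX : y \in X.
    move: gX; rewrite !inE; apply: contra; apply: subset_trans.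
    apply/subsetP => z zg; have := subsetP sub z zg; rewrite !inE le_eqVlt => /orP[/eqP eqz|//].
    by move: zg nlt; rewrite inE eqz => ->.
  have := compg y yX; rewrite /Order.comparable (negPf nle) orbF le_eqVlt (negPf nlt) orbF.
  by move/eqP => eqy; rewrite eqy lexx in nle.
exists y; split=> // [|yX z zX].
  by apply/eqP; rewrite eqEsubset sub; apply/subsetP => z; rewrite !inE => /le_lt_trans; apply.
have := compg z zX; rewrite /Order.comparable le_eqVlt -orbA => /or3P[/eqP->|ltzg|legz].
- by rewrite (ltW ltyg) orbT.
- by have := subsetP sub z; rewrite !inE ltzg => ->.
- by rewrite (le_trans (ltW ltyg) legz) orbT.
Qed.

(** A maximal s above z is comparable to all of [X], since common upper bounds with s equal s.
    Descending from s through unique lower covers keeps this property and ends at z; the least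
    admissible g encodes the descent. *)
Lemma X_chain : chain X.
Proof.
move=> x z xX zX.
pose good g := [forall w in X, (w >=< g)%O].
have goodP g : reflect {in X, forall w, (w >=< g)%O} (good g) by apply: (iffP forall_inP).
have [s maxs lezs] := ex_maximal z.
have sX := X_up _ _ zX lezs.
have goods : good s.
  apply/goodP => w wX; have [u /andP[lewu lesu]] := X_bounded _ _ wX sX.
  by rewrite -(maximalP _ maxs u lesu) /Order.comparable lewu.
pose Q g := [&& g \in X, good g & (z <= g)%O].
have Qs : Q s by rewrite /Q sX goods.
have [g /and3P[gX /goodP goodg lezg] ming] := arg_minnP (fun g => #|dn g|) Qs.
have [<-|nezg] := eqVneq g z; first exact: goodg.
have [y [ltyg sdng goody]] := predecessor _ gX goodg.
have lezy : (z <= y)%O.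
  by move/setP: sdng => /(_ z); rewrite !inE lt_neqAle eq_sym nezg lezg => <-.
have yX := X_up _ _ zX lezy.
have := ming y; rewrite /Q yX lezy andbT; move/(_ (introT (goodP _) (goody yX))).
by rewrite leqNgt [#|dn g|]card_dn sdng ltnS leqnn.
Qed.

Lemma ex_X_bottom : X != set0 -> exists c y,
  [/\ c \in X, y \notin X, sdn c = dn y & {in X, forall z, (c <= z)%O}].
Proof.
case/set0Pn => x0 x0X.
have [c cX minc] := arg_minnP (fun g => #|dn g|) x0X.
have [y [ltyc sdnc _]] : exists y, [/\ (y < c)%O, sdn c = dn y & y \in X -> {in X, forall z, (z >=< y)%O}].
  by apply: predecessor => // z zX; apply: X_chain.
have nX z : (z < c)%O -> z \notin X.
  move=> ltzc; apply/negP => /minc; apply/negP; rewrite -ltnNge; apply: proper_card.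
  by rewrite properE !dnE ltW //= (lt_geF ltzc).
exists c, y; split=> //; first exact: nX.
move=> z zX; have := X_chain z c zX cX; rewrite /Order.comparable le_eqVlt -orbA.
by case/or3P => [/eqP->|/nX|//]; rewrite ?zX.
Qed.

(** Let g be the least element of [X] above z and w its lower cover. Then z <= w, so w is outside
    [X] by minimality of g. This forces g = c, as c < g would give c <= w. *)
Lemma below_X c y z x : {in X, forall z, (c <= z)%O} -> c \in X -> y \notin X -> sdn c = dn y ->
  z \notin X -> x \in X -> (z < x)%O -> (z <= y)%O.
Proof.
move=> minc cX yX sdnc zX xX ltzx.
pose Q g := (g \in X) && (z < g)%O.
have Qx : Q x by rewrite /Q xX.
have [g /andP[gX ltzg] ming] := arg_minnP (fun g => #|dn g|) Qx.
have [w [ltwg sdng _]] : exists w, [/\ (w < g)%O, sdn g = dn w & w \in X -> {in X, forall z, (z >=< w)%O}].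
  by apply: predecessor => // u uX; apply: X_chain.
have lezw : (z <= w)%O by move/setP: sdng => /(_ z); rewrite !inE ltzg => <-.
have wX : w \notin X.
  apply/negP => wX; have := ming w; rewrite /Q wX lt_neqAle lezw andbT.
  have -> /= : z != w by apply: contraNneq zX => ->.
  by rewrite leqNgt [#|dn g|]card_dn sdng ltnS leqnn => /(_ isT).
have eqg : g = c.
  apply/eqP; apply: contraT => negc; case/negP: wX; apply: (X_up _ _ cX).
  have ltcg : c \in sdn g by rewrite inE lt_neqAle eq_sym negc minc.
  by move: ltcg; rewrite sdng inE.
by move/setP: sdnc => /(_ z); rewrite !inE -eqg ltzg => <-.
Qed.

Lemma X_structure : X != set0 ->
  exists2 y, y \notin X &
    [/\ {in X, forall x, (y < x)%O}, forall x, x \notin y |: X -> isolated x & y != t].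
Proof.
move=> /ex_X_bottom[c [y [cX yX sdnc minc]]].
have ltyc : (y < c)%O by move/setP: sdnc => /(_ y); rewrite !inE lexx.
have lty x : x \in X -> (y < x)%O by move/minc; apply: lt_le_trans.
have below z x := @below_X c y z x minc cX yX sdnc.
have yt : ~~ (y < t)%O.
  apply/negP => ltyt; move: cX; rewrite inE sdnc => /negP; apply.
  by apply/subsetP => z; rewrite !inE => /le_lt_trans; apply.
(* Elements of [E] lie below every maximal element, in particular below one above c, so [below_X]
   applies. *)
have ltE e : (e < t)%O -> (e < y)%O.
  move=> ltet; have eX : e \notin X by rewrite inE negbK; apply/sdn_sub/ltW.
  have [s maxs lecs] := ex_maximal c.
  have lees : (e < s)%O by have := subsetP (sub_sdn_maximal s maxs) e; rewrite !inE; apply.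
  have := below e s eX (X_up _ _ cX lecs) lees; rewrite le_eqVlt => /orP[/eqP eqe|//].
  by rewrite eqe (negPf yt) in ltet.
have trichotomy z : z \notin X -> ~~ (z < t)%O -> z = y \/ sdn z = E /\ maximal z.
  move=> zX nzt; have [maxz|nmax] := boolP (maximal z).
    by right; split=> //; apply: maximal_notX.
  have [x xX ltzx] := lt_X _ nzt nmax; left; apply/eqP; have := below z x zX xX ltzx.
  rewrite le_eqVlt => /orP[//|ltzy]; case/negP: nzt.
  by have := subsetP (notX_sub _ yX) z; rewrite !inE; apply.
(* By the case distinction, [E] lies below everything outside it. Once [E] is empty, the points
   outside [X] other than y are both maximal and minimal. *)
have E0 : E = set0.
  apply: no_lower_part => e z ltet nzt; have [zX|zX] := boolP (z \in X).
    exact: lt_trans (ltE e ltet) (lty z zX).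
  case: (trichotomy z zX nzt) => [->|[sdnz _]]; first exact: ltE.
  by move/setP: sdnz => /(_ e); rewrite !inE ltet.
have nE z : ~~ (z < t)%O by move/setP: E0 => /(_ z); rewrite !inE => ->.
exists y => //; split=> // [x|].
  rewrite in_setU1 negb_or => /andP[nexy xX] z.
  case: (trichotomy x xX (nE x)) => [eqx|[sdnx maxx]]; first by rewrite eqx eqxx in nexy.
  rewrite /Order.comparable => /orP[|]; last by move/(maximalP _ maxx).
  rewrite le_eqVlt => /orP[/eqP//|ltzx].
  by move/setP: sdnx => /(_ z); rewrite E0 !inE ltzx.
by apply: contraTneq ltyc => ->; apply/negP => /ltW/(maximalP _ maxt) eqc; move: cX;
  rewrite eqc inE subxx.
Qed.

End Structure.

(** * A chain together with isolated points *)

Lemma isolated_connect x y : isolated x -> connect (fun x y : P => (x >=< y)%O) x y -> y = x.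
Proof.
move=> isox /(closed_connect (a := pred1 x)); rewrite !inE eqxx => eqy; apply/eqP.
rewrite -eqy // => u v; rewrite !inE => cuv; apply/eqP/eqP => eqx.
  by rewrite eqx in cuv *; apply: isox; rewrite comparable_sym.
by rewrite eqx in cuv *; apply: isox.
Qed.

Lemma n_comp_isolated2 c y t1 t2 : (c >=< y)%O -> isolated t1 -> isolated t2 -> t1 != t2 ->
  c \notin [set t1; t2] -> [set: P] = [set c; y; t1; t2] ->
  n_comp (fun x y : P => (x >=< y)%O) P = 3.
Proof.
move=> ccy iso1 iso2 ne12 cT defP.
pose e : rel P := fun x z => (x >=< z)%O.
have esym : connect_sym e by apply: sym_connect_sym => u v; apply: comparable_sym.
have root_iso x z : isolated x -> root e z = x -> z = x.
  by move=> isox eqr; apply: (isolated_connect x) => //; rewrite -eqr esym connect_root.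
have iso_root x : isolated x -> root e x = x.
  by move=> isox; apply: (isolated_connect x) => //; apply: connect_root.
have rcy : root e c = root e y by apply/eqP; rewrite root_connect // connect1.
have defroots : predI (roots e) P =i [set root e c; t1; t2].
  move=> z; rewrite !inE andbT; apply/idP/idP => [/eqP rz|].
    have : z \in [set: P] by rewrite inE.
    rewrite defP !inE -!orbA => /or4P[]/eqP eqz.
    - by rewrite -rz eqz eqxx.
    - by rewrite -rz eqz rcy eqxx.
    - by rewrite -rz eqz iso_root // eqxx orbT.
    - by rewrite -rz eqz iso_root // eqxx !orbT.
  rewrite -orbA => /or3P[]/eqP->; first exact: roots_root.
    by rewrite /roots iso_root.
  by rewrite /roots iso_root.
rewrite /n_comp_mem (eq_card defroots) -setUA cardsU1 cards2 ne12 !inE negb_or.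
move: cT; rewrite !inE negb_or => /andP[c1 c2].
have -> : root e c != t1 by apply: contra c1 => /eqP/(root_iso _ _ iso1) ->.
by have -> : root e c != t2 by apply: contra c2 => /eqP/(root_iso _ _ iso2) ->.
Qed.

(** Elements of [X] lie above y, so they are the non-minimal points needed to shrink three isolated
    points, or two when [X] has two elements. One isolated point gives the class B; two of them with
    a two-element chain give Z. *)
Lemma chain_isolated_cases (X : {set P}) y t :
    X != set0 -> chain X -> y \notin X -> {in X, forall x, (y < x)%O} ->
    (forall x, x \notin y |: X -> isolated x) -> t \notin y |: X ->
  [\/ in_B P, is_Z P | shrinkable].
Proof.
move=> X0 chX yX lty isoT tC; pose C := y |: X; pose T := ~: C.
have isoP x : x \in T -> isolated x by rewrite inE; apply: isoT.
have sdnX x : x \in X -> sdn x != set0.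
  by move=> xX; apply/set0Pn; exists y; rewrite inE lty.
have chC : chain C.
  move=> u v; rewrite !in_setU1 => /predU1P[->|uX] /predU1P[->|vX]; last exact: chX.
  - exact: comparablexx.
  - by rewrite /Order.comparable ltW // lty.
  - by rewrite /Order.comparable orbC ltW // lty.
have cardC : #|C| = #|X|.+1 by rewrite cardsU1 yX.
have [c cX] := set0Pn _ X0.
have T0 : 0 < #|T| by apply/card_gt0P; exists t; rewrite inE.
have cardX : 0 < #|X| by rewrite card_gt0.
have [T3|] := ltnP 2 #|T|.
  case/card_gt2P: T3 => t1 [t2 [t3 [[/isoP i1 /isoP i2 /isoP i3] [n12 n23 n31]]]].
  by constructor 3; apply: (shrinkable_isolated3 t1 t2 t3 c) => //; apply: sdnX.
rewrite leq_eqVlt => /predU1P[/eqP/cards2P[t1 [t2 [n12 defT]]]|]; last first.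
  rewrite ltnS => T1; constructor 1; exists C, T; split=> //.
  - split; first by split; [exact: setUCr | rewrite -subsets_disjoint].
    move=> u v uC vT; apply/negP => /(isoP v vT) eqv.
    by move: vT; rewrite inE -eqv uC.
  - by rewrite cardC.
  - by apply/eqP; rewrite eqn_leq T1.
have [i1 i2] : isolated t1 /\ isolated t2.
  by split; apply: isoP; rewrite defT !inE eqxx ?orbT.
have [/card_gt1P[b [b' [bX b'X nebb']]]|X1] := ltnP 1 #|X|.
  by constructor 3; apply: (shrinkable_isolated2 t1 t2 b b') => //; apply: sdnX.
have /eqP/cards1P[c' defX] : #|X| = 1 by apply/eqP; rewrite eqn_leq X1.
constructor 2; split; first by rewrite -(cardsC C) cardC -/T defT defX cards1 cards2 n12.
apply: (n_comp_isolated2 c y t1 t2) => //.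
- by rewrite /Order.comparable orbC ltW // lty.
- by rewrite -defT !inE cX orbT.
- rewrite -(setUCr C) -/T defT setUA; congr (_ :|: _ :|: _).
  by rewrite /C setUC; move: cX; rewrite defX inE => /eqP->.
Qed.

(** * Classification of blocks *)

Lemma chain_shrinkable : 0 < #|P| -> chain [set: P] -> shrinkable.
Proof.
case/card_gt0P => x0 _ chP; have [x _ minx] := arg_minnP (fun x => #|dn x|) (erefl : predT x0).
(* The least element is the supremum of its empty open down-set. *)
apply: (shrinkable_sup x) => y _; have := chP x y; rewrite !inE => /(_ isT isT)/orP[//|leyx].
have /eqP eqd : dn y == dn x by rewrite eqEcard dnE leyx minx.
by rewrite -dnE eqd.
Qed.

Lemma block_cases : 0 < #|P| -> block P ->
  [\/ antichain [set: P] /\ 2 <= #|P|, in_B P, is_Z P | shrinkable].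
Proof.
move=> P0 [chP|novert]; first by constructor 4; apply: chain_shrinkable.
have [sh|noshrink] := EM shrinkable; first by constructor 4.
have P2 : 2 <= #|P|.
  rewrite leqNgt; apply/negP => P1; case: noshrink; apply: chain_shrinkable => // x y _ _.
  by rewrite (fintype_le1P P1 y x) comparablexx.
have /card_gt0P[x0 _] := P0; have [s0 maxs0 _] := ex_maximal x0.
have [t maxt mint] := arg_minnP (fun s => #|sdn s|) maxs0.
pose X := [set w | ~~ (sdn w \subset sdn t)].
have [X0|X0] := eqVneq X set0.
  by constructor 1; split=> //; apply: (X0_antichain noshrink novert t).
have chX := X_chain noshrink t maxt mint.
have [y yX [lty iso neyt]] := X_structure noshrink novert t maxt mint X0.
have tC : t \notin y |: X by rewrite !inE negb_or eq_sym neyt negbK subxx.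
have [] := chain_isolated_cases _ _ _ X0 chX yX lty iso tC.
- by constructor 2.
- by constructor 3.
- by constructor 4.
Qed.

End Representations.

Theorem theorem5p6 (d : Order.disp_t) (P : finPOrderType d)
  (P_nonempty : 0 < #|P|) (P_block : block P) :
  (dim2 P = #|P| -> in_A234 P \/ in_B P \/ is_Z P) /\
  (cw P = #|P| -> in_A P \/ in_B P \/ is_Z P).
Proof.
have dim2_lt p S : @rep_avoiding _ P p S -> dim2 P <> #|P|.
  by move/dim2_lt_card => lt eqd; rewrite eqd ltnn in lt.
have [[antiP P2]|inB|inZ|sh] := block_cases P_nonempty P_block.
- split=> [eqd|_]; left; split=> //; rewrite !inE.
  (* More than four elements contradict [dim2 P] = |P|; for [cw] every size from two on is
     allowed. *)
  have [/(antichain_rep_avoiding antiP)[p [S /dim2_lt[]]]//|] := ltnP 4 #|P|.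
  by case: #|P| P2 => [|[|[|[|[|]]]]].
- by split=> _; right; left.
- by split=> _; right; right.
split=> [eqd|]; last by move/(shrinkable_cw P_nonempty sh).
by case: sh => p [S [/dim2_lt[]]].
Qed.
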